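(* There is a one-to-one correspondence between quadruples of Williamson-type sequences of length $n$ and perfect sequences of length $n$ over $\mathcal Q_+$.
   Context: Here $n$ is a positive integer. $\mathbb H$ is the real algebra of quaternions with basic units $\mathbf i,\mathbf j,\mathbf k$ ($\mathbf i^2=\mathbf j^2=\mathbf k^2=-1$, $\mathbf i\mathbf j=\mathbf k$, $\mathbf j\mathbf i=-\mathbf k$), and $x\mapsto x^*$ is quaternion conjugation. Put $q=(1+\mathbf i+\mathbf j+\mathbf k)/2$, $\mathcal Q_8=\{\pm1,\pm\mathbf i,\pm\mathbf j,\pm\mathbf k\}$ and $\mathcal Q_+=\mathcal Q_8\cup q\mathcal Q_8$ (a set of 16 unit quaternions). A sequence $S=[s_0,\dots,s_{n-1}]$ of quaternions is perfect if its periodic autocorrelation vanishes at all nonzero shifts, i.e. $\sum_{r=0}^{n-1}s_r\,s_{(r+t)\bmod n}^*=0$ for all $1\le t<n$. A perfect sequence over $\mathcal Q_+$ is a perfect sequence all of whose entries lie in $\mathcal Q_+$. For $\{\pm1\}$-sequences $X=[x_0,\dots,x_{n-1}]$ and $Y=[y_0,\dots,y_{n-1}]$ of length $n$ and $0\le t<n$, let $R_{X,Y}(t)=\sum_{r=0}^{n-1}x_r\,y_{(r+t)\bmod n}$ and $R_X(t)=R_{X,X}(t)$. A quadruple $(A,B,C,D)$ of sequences in $\{\pm1\}^n$ is a quadruple of Williamson-type sequences if for all $0\le t<n$ one has $R_A(t)+R_B(t)+R_C(t)+R_D(t)=4n\,\delta_{0,t}$ (where $\delta_{0,t}$ is the Kronecker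 delta) and $R_{X,Y}(t)-R_{Y,X}(t)=0$ for all $X,Y\in\{A,B,C,D\}$. *)

(* Defs.v *)
From HB Require Import structures.
From mathcomp Require Import all_boot all_order all_algebra.
From mathcomp Require Import ring.
From mathcomp Require Import boolp classical_sets functions reals.

Set Implicit Arguments.
Unset Strict Implicit.
Unset Printing Implicit Defensive.

Import Order.TTheory GRing.Theory Num.Theory.
Local Open Scope ring_scope.
Local Open Scope classical_set_scope.

(* [Quat a b c d] is a + b i + c j + d k. *)
Record quaternion (R : realType) :=
  Quat { qre : R; qim_i : R; qim_j : R; qim_k : R }.

Section QuaternionAlgebra.
Variable R : realType.
Local Notation H := (quaternion R).
Implicit Types x y z : H.

Definition tuple_of_quat x : R * R * R * R :=
  (qre x, qim_i x, qim_j x, qim_k x).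
Definition quat_of_tuple (u : R * R * R * R) : H :=
  let: (a, b, c, d) := u in Quat a b c d.
Lemma tuple_of_quatK : cancel tuple_of_quat quat_of_tuple.
Proof. by case. Qed.

HB.instance Definition _ := Equality.copy H (can_type tuple_of_quatK).
HB.instance Definition _ := Choice.copy H (can_type tuple_of_quatK).

Definition quat_zero : H := Quat 0 0 0 0.
Definition quat_opp x : H :=
  Quat (- qre x) (- qim_i x) (- qim_j x) (- qim_k x).
Definition quat_add x y : H :=
  Quat (qre x + qre y) (qim_i x + qim_i y)
       (qim_j x + qim_j y) (qim_k x + qim_k y).

Lemma quat_addA : associative quat_add.
Proof. by move=> [? ? ? ?] [? ? ? ?] [? ? ? ?]; congr Quat => /=; ring. Qed.
Lemma quat_addC : commutative quat_add.
Proof. by move=> [? ? ? ?] [? ? ? ?]; congr Quat => /=; ring. Qed.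
Lemma quat_add0 : left_id quat_zero quat_add.
Proof. by move=> [? ? ? ?]; congr Quat => /=; ring. Qed.
Lemma quat_addN : left_inverse quat_zero quat_opp quat_add.
Proof. by move=> [? ? ? ?]; congr Quat => /=; ring. Qed.

HB.instance Definition _ :=
  GRing.isZmodule.Build H quat_addA quat_addC quat_add0 quat_addN.

Definition quat_one : H := Quat 1 0 0 0.
(* The bilinear extension of the relations [quat_basis_mul] below. *)
Definition quat_mul x y : H :=
  let: Quat a b c d := x in let: Quat a' b' c' d' := y in
  Quat (a * a' - b * b' - c * c' - d * d')
       (a * b' + b * a' + c * d' - d * c')
       (a * c' - b * d' + c * a' + d * b')
       (a * d' + b * c' - c * b' + d * a').

Lemma quat_mulA : associative quat_mul.
Proof. by move=> [? ? ? ?] [? ? ? ?] [? ? ? ?]; congr Quat => /=; ring. Qed.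
Lemma quat_mul1l : left_id quat_one quat_mul.
Proof. by move=> [? ? ? ?]; congr Quat => /=; ring. Qed.
Lemma quat_mul1r : right_id quat_one quat_mul.
Proof. by move=> [? ? ? ?]; congr Quat => /=; ring. Qed.
Lemma quat_mulDl : left_distributive quat_mul quat_add.
Proof. by move=> [? ? ? ?] [? ? ? ?] [? ? ? ?]; congr Quat => /=; ring. Qed.
Lemma quat_mulDr : right_distributive quat_mul quat_add.
Proof. by move=> [? ? ? ?] [? ? ? ?] [? ? ? ?]; congr Quat => /=; ring. Qed.
Lemma quat_one_neq0 : quat_one != 0.
Proof. by apply/eqP => -[] /eqP; rewrite oner_eq0. Qed.

HB.instance Definition _ := GRing.Zmodule_isNzRing.Build H
  quat_mulA quat_mul1l quat_mul1r quat_mulDl quat_mulDr quat_one_neq0.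

Definition quat_scale (a : R) x : H :=
  Quat (a * qre x) (a * qim_i x) (a * qim_j x) (a * qim_k x).

Lemma quat_scaleA a b x :
  quat_scale a (quat_scale b x) = quat_scale (a * b) x.
Proof. by case: x => *; congr Quat => /=; ring. Qed.
Lemma quat_scale1 : left_id 1 quat_scale.
Proof. by move=> [? ? ? ?]; congr Quat => /=; ring. Qed.
Lemma quat_scaleDr : right_distributive quat_scale +%R.
Proof. by move=> ? [? ? ? ?] [? ? ? ?]; congr Quat => /=; ring. Qed.
Lemma quat_scaleDl x : {morph quat_scale^~ x : a b / a + b}.
Proof. by case: x => * ? ?; congr Quat => /=; ring. Qed.

HB.instance Definition _ := GRing.Zmodule_isLmodule.Build R H
  quat_scaleA quat_scale1 quat_scaleDr quat_scaleDl.

Lemma quat_scaleAl (a : R) x y : a *: (x * y) = (a *: x) * y.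
Proof. by case: x y => [? ? ? ?] [? ? ? ?]; congr Quat => /=; ring. Qed.
HB.instance Definition _ := GRing.Lmodule_isLalgebra.Build R H quat_scaleAl.

Lemma quat_scaleAr (a : R) x y : a *: (x * y) = x * (a *: y).
Proof. by case: x y => [? ? ? ?] [? ? ? ?]; congr Quat => /=; ring. Qed.
HB.instance Definition _ := GRing.Lalgebra_isAlgebra.Build R H quat_scaleAr.

Definition quat_conj x : H :=
  Quat (qre x) (- qim_i x) (- qim_j x) (- qim_k x).

Definition quat_i : H := Quat 0 1 0 0.
Definition quat_j : H := Quat 0 0 1 0.
Definition quat_k : H := Quat 0 0 0 1.

Lemma quat_basis_mul :
  [/\ quat_i * quat_i = -1, quat_j * quat_j = -1, quat_k * quat_k = -1,
      quat_i * quat_j = quat_k & quat_j * quat_i = - quat_k].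
Proof. by split; congr Quat => /=; ring. Qed.

Lemma quatE x : x = (qre x)%:A + qim_i x *: quat_i
                    + qim_j x *: quat_j + qim_k x *: quat_k.
Proof. by case: x => *; congr Quat => /=; ring. Qed.

Definition quat_q : H := 2^-1 *: (1 + quat_i + quat_j + quat_k).

Definition Q8 : seq H :=
  [:: 1; -1; quat_i; - quat_i; quat_j; - quat_j; quat_k; - quat_k].
Definition Qplus : seq H := Q8 ++ [seq quat_q * u | u <- Q8].

End QuaternionAlgebra.

Section Sequences.
Variables (R : realType) (n : nat).

Definition quat_autocorr (S : n.-tuple (quaternion R)) (t : nat) :
    quaternion R :=
  \sum_(0 <= r < n) S`_r * quat_conj S`_((r + t) %% n).

Definition perfect (S : n.-tuple (quaternion R)) : Prop :=
  forall t : nat, (1 <= t < n)%N -> quat_autocorr S t = 0.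

Definition perfect_Qplus_seqs : set (n.-tuple (quaternion R)) :=
  [set S | perfect S /\ {subset S <= Qplus R}].

Definition crosscorr (X Y : n.-tuple int) (t : nat) : int :=
  \sum_(0 <= r < n) X`_r * Y`_((r + t) %% n).

Definition pm1_seq (X : n.-tuple int) : Prop := {subset X <= [:: 1; -1 : int]}.

Definition williamson_type (A B C D : n.-tuple int) : Prop :=
  [/\ [/\ pm1_seq A, pm1_seq B, pm1_seq C & pm1_seq D],
      forall t : nat, (t < n)%N ->
        crosscorr A A t + crosscorr B B t + crosscorr C C t + crosscorr D D t
        = (4 * n)%:R * (t == 0%N)%:R
    & forall X Y : n.-tuple int,
        X \in [:: A; B; C; D] -> Y \in [:: A; B; C; D] ->
        forall t : nat, (t < n)%N -> crosscorr X Y t - crosscorr Y X t = 0].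

Definition williamson_type_quadruples :
    set (n.-tuple int * n.-tuple int * n.-tuple int * n.-tuple int) :=
  [set w | let: (A, B, C, D) := w in williamson_type A B C D].

End Sequences.

Arguments williamson_type_quadruples n : clear implicits.
Arguments perfect_Qplus_seqs R n : clear implicits.

(* Main.v *)
(** Left multiplication by [q] maps [Qplus] onto the sixteen quaternions
    (±1±i±j±k)/2 and preserves perfection, so a sequence over [Qplus]
    amounts to four binary sequences [A, B, C, D].  The real part of its
    autocorrelation is (R_A + R_B + R_C + R_D)/4, but its imaginary parts only
    control sums such as (R_{B,A} - R_{A,B}) + (R_{D,C} - R_{C,D}).  To separate the
    two terms, one uses that a perfect sequence is also perfect for the
    opposite products [s_r^* s_{r+t}], whose imaginary parts involve the
    differences of the same terms.  Writing [L t] for the sum of the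
    [s_r^* s_{r+t}], this holds because perfection forces
    sum_t |L t|^2 = |L 0|^2. *)
Require Import Defs.
From mathcomp Require Import all_boot all_order all_algebra.
From mathcomp Require Import ring lra zify.
From mathcomp Require Import boolp classical_sets functions reals.

Set Implicit Arguments.
Unset Strict Implicit.
Unset Printing Implicit Defensive.

Import Order.TTheory GRing.Theory Num.Theory.
Local Open Scope ring_scope.

(** * Norms, and perfection for the two orders of multiplication *)

Section QuaternionTheory.
Variable R : realType.
Local Notation H := (quaternion R).
Implicit Types x y : H.

Definition quat_normsq x : R :=
  qre x ^+ 2 + qim_i x ^+ 2 + qim_j x ^+ 2 + qim_k x ^+ 2.

Lemma quat_conjD : {morph @quat_conj R : x y / x + y}.
Proof. by move=> [? ? ? ?] [? ? ? ?]; congr Quat => /=; ring. Qed.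

Lemma quat_conj0 : quat_conj (0 : H) = 0.
Proof. by congr Quat; rewrite /= oppr0. Qed.

Lemma quat_conjM x y : quat_conj (x * y) = quat_conj y * quat_conj x.
Proof. by case: x y => [? ? ? ?] [? ? ? ?]; congr Quat => /=; ring. Qed.

Lemma quat_conjK : involutive (@quat_conj R).
Proof. by move=> [? ? ? ?]; congr Quat => /=; ring. Qed.

Lemma quat_mul_conj x : x * quat_conj x = (quat_normsq x)%:A.
Proof. by case: x => *; congr Quat; rewrite /quat_normsq /=; ring. Qed.

Lemma quat_conj_mul x : quat_conj x * x = (quat_normsq x)%:A.
Proof. by case: x => *; congr Quat; rewrite /quat_normsq /=; ring. Qed.

Lemma quat_normsq_ge0 x : 0 <= quat_normsq x.
Proof. by rewrite /quat_normsq !addr_ge0 ?sqr_ge0. Qed.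

Lemma quat_normsq_eq0 x : quat_normsq x = 0 -> x = 0.
Proof.
case: x => a b c d /eqP; rewrite /quat_normsq /=.
rewrite !paddr_eq0 ?addr_ge0 ?sqr_ge0 // !sqrf_eq0.
by case/andP=> /andP[/andP[/eqP-> /eqP->] /eqP->] /eqP->.
Qed.

Lemma quat_normsqZ1 (a : R) : quat_normsq (a%:A : H) = a ^+ 2.
Proof. by rewrite /quat_normsq /=; ring. Qed.

Lemma qre_sum (I : Type) (r : seq I) (F : I -> H) :
  qre (\sum_(i <- r) F i) = \sum_(i <- r) qre (F i).
Proof. by apply: (big_morph (@qre R)) => // -[? ? ? ?] [? ? ? ?]. Qed.

Lemma qim_i_sum (I : Type) (r : seq I) (F : I -> H) :
  qim_i (\sum_(i <- r) F i) = \sum_(i <- r) qim_i (F i).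
Proof. by apply: (big_morph (@qim_i R)) => // -[? ? ? ?] [? ? ? ?]. Qed.

Lemma qim_j_sum (I : Type) (r : seq I) (F : I -> H) :
  qim_j (\sum_(i <- r) F i) = \sum_(i <- r) qim_j (F i).
Proof. by apply: (big_morph (@qim_j R)) => // -[? ? ? ?] [? ? ? ?]. Qed.

Lemma qim_k_sum (I : Type) (r : seq I) (F : I -> H) :
  qim_k (\sum_(i <- r) F i) = \sum_(i <- r) qim_k (F i).
Proof. by apply: (big_morph (@qim_k R)) => // -[? ? ? ?] [? ? ? ?]. Qed.

Lemma quat_conj_sum (I : Type) (r : seq I) (F : I -> H) :
  quat_conj (\sum_(i <- r) F i) = \sum_(i <- r) quat_conj (F i).
Proof. exact: (big_morph _ quat_conjD quat_conj0). Qed.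

(** The sum of the squared norms of the left autocorrelations is computed from the right ones alone.
    It turns out to be the contribution of shift 0, so the other terms, being nonnegative, are
    zero. *)
Lemma left_autocorr_eq0 (G : finZmodType) (s : G -> H) :
  (forall t, t != 0 -> \sum_r s r * quat_conj (s (r + t)) = 0) ->
  forall t, t != 0 -> \sum_r quat_conj (s r) * s (r + t) = 0.
Proof.
move=> s_perf.
pose L t := \sum_r quat_conj (s r) * s (r + t).
pose c := \sum_r quat_normsq (s r).
have L0 : L 0 = c%:A.
  rewrite /L /c scaler_suml; apply: eq_bigr => r _.
  by rewrite addr0 quat_conj_mul.
(* Replacing [t] by [- r + t] turns this into the right autocorrelation at shift [u - r]. *)
have sP r u : \sum_t s (r + t) * quat_conj (s (u + t)) = if u == r then c%:A else 0.
  rewrite (reindex_inj (addrI (- r))) /=.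
  case: eqVneq => [->|ur].
    rewrite /c scaler_suml; apply: eq_bigr => t _.
    by rewrite addrA subrr add0r quat_mul_conj.
  rewrite -[RHS](s_perf (u - r)) ?subr_eq0 //; apply: eq_bigr => t _.
  by rewrite addrA subrr add0r [in RHS]addrC addrA.
have sumL : \sum_t L t * quat_conj (L t) = (c ^+ 2)%:A.
  (* Conjugation reverses products, so the two factors that depend on [t] become adjacent, and
     summing over [t] first brings in [sP]. *)
  transitivity (\sum_r \sum_u quat_conj (s r) *
      (\sum_t s (r + t) * quat_conj (s (u + t))) * s u).
    rewrite /L; under eq_bigr => t _.
      rewrite quat_conj_sum mulr_suml.
      under eq_bigr => r _ do rewrite mulr_sumr.
      over.
    rewrite exchange_big; apply: eq_bigr => r _.
    rewrite exchange_big; apply: eq_bigr => u _.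
    rewrite mulr_sumr mulr_suml; apply: eq_bigr => t _.
    by rewrite quat_conjM quat_conjK !mulrA.
  (* Only the diagonal [u = r] survives, leaving [c] times [L 0]. *)
  rewrite expr2 -scalerA -[c%:A in RHS]L0 /L scaler_sumr.
  apply: eq_bigr => r _; rewrite (bigD1 r) //= sP eqxx big1 => [|u ur].
    by rewrite !addr0 -scalerAr mulr1 -scalerAl.
  by rewrite sP (negPf ur) mulr0 mul0r.
have sumN : \sum_t quat_normsq (L t) = c ^+ 2.
  have := congr1 (@qre R) sumL; rewrite qre_sum /= mulr1 => <-.
  by apply: eq_bigr => t _; rewrite quat_mul_conj /= mulr1.
move: sumN; rewrite (bigD1 0) //= L0 quat_normsqZ1 => /eqP.
rewrite -subr_eq0 addrAC subrr add0r => /eqP sum0 t t0.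
apply: quat_normsq_eq0; apply: (psumr_eq0P _ sum0) t0 => u _.
exact: quat_normsq_ge0.
Qed.

End QuaternionTheory.

(** * The sixteen quaternions (±1±i±j±k)/2 *)

Section HalfSigns.
Variable R : realType.
Local Notation H := (quaternion R).
Local Notation q := (quat_q R).

Definition half_quat (a b c d : int) : H :=
  Quat (a%:~R / 2) (b%:~R / 2) (c%:~R / 2) (d%:~R / 2).

Lemma half_quat_inj (a b c d a' b' c' d' : int) :
  half_quat a b c d = half_quat a' b' c' d' ->
  [/\ a = a', b = b', c = c' & d = d'].
Proof.
have half_inj (u v : int) : u%:~R / 2 = v%:~R / 2 :> R -> u = v.
  by move=> E; apply/eqP; rewrite -(eqr_int R); apply/eqP; lra.
by case=> /half_inj-> /half_inj-> /half_inj-> /half_inj->.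
Qed.

(** Since [q] has norm 1, its inverse is its conjugate. *)
Lemma conj_q_mulK : cancel ( *%R q) ( *%R (quat_conj q)).
Proof. by move=> [? ? ? ?]; congr Quat => /=; field. Qed.

Lemma q_mul_conjK : cancel ( *%R (quat_conj q)) ( *%R q).
Proof. by move=> [? ? ? ?]; congr Quat => /=; field. Qed.

(* Listed in the order of [Qplus]. *)
Definition sign_quads : seq (int * int * int * int) :=
  [:: (1, 1, 1, 1); (-1, -1, -1, -1); (-1, 1, 1, -1); (1, -1, -1, 1);
      (-1, -1, 1, 1); (1, 1, -1, -1); (-1, 1, -1, 1); (1, -1, 1, -1);
      (-1, 1, 1, 1); (1, -1, -1, -1); (-1, -1, 1, -1); (1, 1, -1, 1);
      (-1, -1, -1, 1); (1, 1, 1, -1); (-1, 1, -1, -1); (1, -1, 1, 1)].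

(** The products of [q] with [Q8] have an even number of minus signs. Those of q^2 = (-1+i+j+k)/2
    with [Q8] have an odd number. *)
Lemma mul_q_Qplus : [seq q * x | x <- Qplus R] =
  [seq half_quat u.1.1.1 u.1.1.2 u.1.2 u.2 | u <- sign_quads].
Proof.
rewrite /Qplus /Q8 /sign_quads /=.
by do 15! [congr cons; first by congr Quat => /=; field];
   congr cons; congr Quat => /=; field.
Qed.

Lemma half_quat_Qplus (a b c d : int) :
    a \in [:: 1; -1] -> b \in [:: 1; -1] -> c \in [:: 1; -1] ->
    d \in [:: 1; -1] ->
  quat_conj q * half_quat a b c d \in Qplus R.
Proof.
move=> ha hb hc hd; rewrite -(mem_map (can_inj conj_q_mulK)) q_mul_conjK.
rewrite mul_q_Qplus; apply/mapP; exists (a, b, c, d) => //.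
move: ha hb hc hd; rewrite !inE.
by do 4! [case/pred2P=> ->].
Qed.

Lemma sgz_half (a : int) : a \in [:: 1; -1] -> sgz (a%:~R / 2 : R) = a.
Proof.
rewrite !inE => /pred2P[] ->; first by rewrite gtr0_sgz //; lra.
by rewrite ltr0_sgz //; lra.
Qed.

(** Inverse of [half_quat] on quadruples of signs; it is used to build preimages. *)
Definition quat_signs (x : H) : int * int * int * int :=
  (sgz (qre x), sgz (qim_i x), sgz (qim_j x), sgz (qim_k x)).

Lemma Qplus_signs (x : H) (a b c d : int) :
    x \in Qplus R -> (a, b, c, d) = quat_signs (q * x) ->
  [/\ a \in [:: 1; -1], b \in [:: 1; -1], c \in [:: 1; -1],
      d \in [:: 1; -1] & quat_conj q * half_quat a b c d = x].
Proof.
move=> /(map_f ( *%R q)); rewrite mul_q_Qplus => /mapP[[[[a' b'] c'] d'] hu /= E].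
have [ha hb hc hd] : [/\ a' \in [:: 1; -1], b' \in [:: 1; -1],
    c' \in [:: 1; -1] & d' \in [:: 1; -1]].
  have /allP/(_ _ hu) : all (fun u : int * int * int * int =>
    [&& u.1.1.1 \in [:: 1; -1], u.1.1.2 \in [:: 1; -1], u.1.2 \in [:: 1; -1]
      & u.2 \in [:: 1; -1]]) sign_quads by [].
  by case/and4P.
rewrite E /quat_signs /= !sgz_half // => -[-> -> -> ->].
by split=> //; rewrite -E conj_q_mulK.
Qed.

End HalfSigns.

(** * Quaternion autocorrelations in terms of binary cross-correlations *)

Section Correlations.
Variables (R : realType) (m : nat).
Local Notation H := (quaternion R).
Local Notation q := (quat_q R).
Local Notation n := m.+1.

(** Addition in ['I_n] is taken modulo [n]. Periodic shifts thus become translations of a finite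
    abelian group, as [left_autocorr_eq0] expects. *)
Lemma crosscorr_ord (X Y : n.-tuple int) (t : 'I_n) :
  crosscorr X Y t = \sum_(r < n) X`_r * Y`_(r + t : 'I_n)%R.
Proof. exact: big_mkord. Qed.

Lemma quat_autocorr_ord (S : n.-tuple H) (t : 'I_n) :
  quat_autocorr S t = \sum_(r < n) S`_r * quat_conj S`_(r + t : 'I_n)%R.
Proof. exact: big_mkord. Qed.

Lemma perfect_ordP (S : n.-tuple H) :
  perfect S <-> forall t : 'I_n, t != 0 -> quat_autocorr S t = 0.
Proof.
split=> [perf t t0 | perf t /andP[t0 tn]].
  by apply: perf; rewrite ltn_ord lt0n andbT.
by apply: (perf (Ordinal tn)); rewrite -val_eqE /= -lt0n.
Qed.

Variables A B C D : n.-tuple int.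

Local Notation h := (fun r : 'I_n => half_quat R A`_r B`_r C`_r D`_r).
Local Notation cc := (@crosscorr n).

Lemma half_quat_autocorr (t : 'I_n) :
  \sum_(r < n) h r * quat_conj (h (r + t)) = 4^-1 *: Quat
    (cc A A t + cc B B t + cc C C t + cc D D t)%:~R
    ((cc B A t - cc A B t) + (cc D C t - cc C D t))%:~R
    ((cc C A t - cc A C t) + (cc B D t - cc D B t))%:~R
    ((cc D A t - cc A D t) + (cc C B t - cc B C t))%:~R.
Proof.
rewrite !crosscorr_ord -!sumrB -!big_split /=.
rewrite [LHS]quatE [RHS]quatE qre_sum qim_i_sum qim_j_sum qim_k_sum /=.
rewrite !rmorph_sum !mulr_sumr.
by congr (_%:A + _ *: _ + _ *: _ + _ *: _); apply: eq_bigr => r _;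
  rewrite !(rmorphD, rmorphN, rmorphM) /=; field.
Qed.

(** Compared with [half_quat_autocorr], conjugating the left factor negates the brackets that pair
    the real part [A] with an imaginary part. The brackets that pair two imaginary parts come from
    the cross product and keep their sign. *)
Lemma half_quat_left_autocorr (t : 'I_n) :
  \sum_(r < n) quat_conj (h r) * h (r + t) = 4^-1 *: Quat
    (cc A A t + cc B B t + cc C C t + cc D D t)%:~R
    ((cc A B t - cc B A t) + (cc D C t - cc C D t))%:~R
    ((cc A C t - cc C A t) + (cc B D t - cc D B t))%:~R
    ((cc A D t - cc D A t) + (cc C B t - cc B C t))%:~R.
Proof.
rewrite !crosscorr_ord -!sumrB -!big_split /=.
rewrite [LHS]quatE [RHS]quatE qre_sum qim_i_sum qim_j_sum qim_k_sum /=.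
rewrite !rmorph_sum !mulr_sumr.
by congr (_%:A + _ *: _ + _ *: _ + _ *: _); apply: eq_bigr => r _;
  rewrite !(rmorphD, rmorphN, rmorphM) /=; field.
Qed.

(** The map of the bijection; [quat_conj q], the inverse of [q], brings the half-sign quaternions
    back into [Qplus]. *)
Definition quat_seq : n.-tuple H :=
  [tuple quat_conj q * half_quat R A`_r B`_r C`_r D`_r | r < n].

Lemma nth_quat_seq (r : 'I_n) : quat_seq`_r = quat_conj q * h r.
Proof. by rewrite -tnth_nth tnth_mktuple. Qed.

(** A constant left factor [quat_conj q] sandwiches each autocorrelation between [quat_conj q] and
    [q], both invertible. *)
Lemma perfect_quat_seqP : perfect quat_seq <->
  forall t : 'I_n, t != 0 -> \sum_(r < n) h r * quat_conj (h (r + t)) = 0.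
Proof.
rewrite perfect_ordP.
have E (t : 'I_n) : quat_autocorr quat_seq t =
    quat_conj q * (\sum_(r < n) h r * quat_conj (h (r + t))) * q.
  rewrite quat_autocorr_ord mulr_sumr mulr_suml; apply: eq_bigr => r _.
  by rewrite !nth_quat_seq quat_conjM quat_conjK !mulrA.
split=> perf t t0; last by rewrite E perf // mulr0 mul0r.
have {perf t0} := perf t t0; rewrite E => P0.
have qq1 : q * quat_conj q = 1 by rewrite -[quat_conj q]mulr1 q_mul_conjK.
set P := \sum_(r < n) _ in P0 *.
by rewrite -[P]mulr1 -qq1 mulrA -[P * q]q_mul_conjK [quat_conj q * _]mulrA P0 mulr0 mul0r.
Qed.

Lemma crosscorr0C (X Y : n.-tuple int) : cc X Y 0%N = cc Y X 0%N.
Proof.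
rewrite (crosscorr_ord X Y 0) (crosscorr_ord Y X 0).
by apply: eq_bigr => r _; rewrite addr0 mulrC.
Qed.

Lemma pm1_crosscorr0 (X : n.-tuple int) : pm1_seq X -> cc X X 0%N = n%:R.
Proof.
move=> X1; rewrite (crosscorr_ord X X 0) (eq_bigr (fun=> 1)) => [|r _].
  by rewrite sumr_const card_ord.
rewrite addr0; have : X`_r \in [:: 1; -1 : int].
  by apply: X1; rewrite mem_nth // size_tuple.
by rewrite !inE => /pred2P[] ->.
Qed.

Lemma perfect_quat_seq_williamson :
    pm1_seq A -> pm1_seq B -> pm1_seq C -> pm1_seq D ->
  perfect quat_seq <-> williamson_type A B C D.
Proof.
move=> A1 B1 C1 D1; rewrite perfect_quat_seqP; split=> [perf | [_ sum4 sym] t t0].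
  have corr (t : 'I_n) : t != 0 ->
     cc A A t + cc B B t + cc C C t + cc D D t = 0 /\
     [/\ cc A B t = cc B A t, cc A C t = cc C A t, cc A D t = cc D A t &
       [/\ cc B C t = cc C B t, cc B D t = cc D B t & cc C D t = cc D C t]].
    move=> t0.
    have quarter0 (x : H) : 4^-1 *: x = 0 -> x = 0.
      by move/eqP; rewrite scaler_eq0 invr_eq0 pnatr_eq0 => /eqP.
    have := left_autocorr_eq0 perf t0.
    rewrite half_quat_left_autocorr => /quarter0[_ /eqP+ /eqP+ /eqP+].
    rewrite !intr_eq0 => /eqP li /eqP lj /eqP lk.
    have := perf t t0.
    rewrite half_quat_autocorr => /quarter0[/eqP+ /eqP+ /eqP+ /eqP+].
    rewrite !intr_eq0 => /eqP ? /eqP ? /eqP ? /eqP ?.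
    (* In each imaginary coordinate, adding and subtracting the left and right equations separates
       the two brackets, which gives all six symmetries. *)
    by do ![split=> //]; lia.
  (* Perfection is silent at shift 0. There the total is [4 * n] because the entries square to 1,
     and symmetry is commutativity. *)
  have cases (P : nat -> Prop) : P 0%N -> (forall t : 'I_n, t != 0 -> P t) ->
      forall t, (t < n)%N -> P t.
    move=> P0 Pt t tn; case: (eqVneq (Ordinal tn) 0) => [[->] //|].
    exact: Pt.
  split=> // [|X Y XABCD YABCD]; apply: cases => [|t t0].
  - by rewrite !pm1_crosscorr0 //; lia.
  - have [-> _] := corr t t0.
    by rewrite [(t == _ :> nat)](negPf t0) mulr0.
  - by rewrite crosscorr0C subrr.
  - have [_ [? ? ? [? ? ?]]] := corr t t0; apply/eqP; rewrite subr_eq0; apply/eqP.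
    by move: XABCD YABCD; rewrite !inE => /or4P[] /eqP-> /or4P[] /eqP->.
(* Conversely, the sum condition kills the real part and symmetry kills every bracket. *)
rewrite half_quat_autocorr sum4 // [(t == _ :> nat)](negPf t0) mulr0.
by rewrite !sym ?inE ?eqxx ?orbT // !addr0 /= scaler0.
Qed.

End Correlations.

Theorem theorem5 (R : realType) (n : nat) (hn : (0 < n)%N) :
  exists f : n.-tuple int * n.-tuple int * n.-tuple int * n.-tuple int ->
             n.-tuple (quaternion R),
    set_bij (williamson_type_quadruples n) (perfect_Qplus_seqs R n) f.
Proof.
case: n hn => // m _.
exists (fun w => let: (A, B, C, D) := w in quat_seq R A B C D); split.
- move=> [[[A B] C] D] W.
  have [[A1 B1 C1 D1] _ _] := W; split.
    exact/perfect_quat_seq_williamson.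
  move=> _ /tnthP[r ->]; rewrite tnth_mktuple.
  by apply: half_quat_Qplus; rewrite -tnth_nth;
    [apply: A1 | apply: B1 | apply: C1 | apply: D1]; apply: mem_tnth.
- move=> [[[A B] C] D] [[[A' B'] C'] D'] _ _ E.
  have {}E (r : 'I_m.+1) :
      (* Injectivity: cancel [quat_conj q] in each entry, then compare coordinates. *)
      [/\ A`_r = A'`_r, B`_r = B'`_r, C`_r = C'`_r & D`_r = D'`_r].
    apply/(@half_quat_inj R)/(can_inj (@q_mul_conjK R)).
    by rewrite -!nth_quat_seq E.
  by congr (_, _, _, _); apply: eq_from_tnth => r; rewrite !(tnth_nth 0);
    have [] := E r.
- move=> S [perf SQ].
  (* Surjectivity: each [q * s_r] has coordinates ±1/2, whose signs give the four binary
     sequences. *)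
  pose sgn r := quat_signs (quat_q R * S`_r).
  pose A := [tuple (sgn r).1.1.1 | r < m.+1].
  pose B := [tuple (sgn r).1.1.2 | r < m.+1].
  pose C := [tuple (sgn r).1.2 | r < m.+1].
  pose D := [tuple (sgn r).2 | r < m.+1].
  have Smem (r : 'I_m.+1) : S`_r \in Qplus R.
    by apply: SQ; rewrite mem_nth // size_tuple.
  have SP (r : 'I_m.+1) := Qplus_signs (Smem r) (erefl (sgn r)).
  have SE : quat_seq R A B C D = S.
    apply: eq_from_tnth => r; rewrite !(tnth_nth 0) nth_quat_seq -!tnth_nth.
    by rewrite !tnth_mktuple (tnth_nth 0); have [] := SP r.
  exists (A, B, C, D) => //=; apply/(perfect_quat_seq_williamson R); rewrite ?SE //.
  all: by move=> _ /tnthP[r ->]; rewrite tnth_mktuple; have [] := SP r.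
Qed.
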